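(* There exists a positive constant $c$ such that for all sufficiently large positive integers $r$, \[ G(r) > 2^{c (\log r)^{5/2}/\sqrt{\log \log r}}. \]
   Context: All logarithms are base 2. For positive integers $m,n$, the grid graph $\Gamma_{m,n}$ is the graph on vertex set $[m]\times[n]$ in which distinct vertices $(i,j),(i',j')$ are adjacent iff $i=i'$ or $j=j'$ (i.e. the Cartesian product $K_m\times K_n$). A rectangle is the induced subgraph on $\{(i,j),(i',j),(i,j'),(i',j')\}$ with $i<i'$, $j<j'$. In an edge coloring, a rectangle is alternating if the edges $\{(i,j),(i',j)\}$ and $\{(i,j'),(i',j')\}$ have the same color and the edges $\{(i,j),(i,j')\}$ and $\{(i',j),(i',j')\}$ have the same color. $G(r)$ is the minimum integer $n$ such that every edge coloring of $\Gamma_{n,n}$ with $r$ colors contains an alternating rectangle. *)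

(* Defs.v *)
From mathcomp Require Import all_boot.
From Stdlib Require Import Reals.
Set Implicit Arguments.
Unset Strict Implicit.

(* Vertices of the grid graph Gamma_{n,n} = K_n x K_n : [n] x [n] (0-indexed). *)
Definition vertex (n : nat) : Type := ('I_n * 'I_n)%type.

(* An r-edge-coloring of Gamma_{n,n}: a color in 'I_r for every (unordered)
   pair of vertices; only its values on edges (pairs in the same row or
   column) are ever used.  Unorderedness is imposed by [sym_coloring]. *)
Definition coloring (n r : nat) : Type := vertex n -> vertex n -> 'I_r.

Definition sym_coloring (n r : nat) (f : coloring n r) : Prop :=
  forall u v, f u v = f v u.

Definition has_alt_rect (n r : nat) (f : coloring n r) : Prop :=
  exists i i' j j' : 'I_n,
    (i < i')%N /\ (j < j')%N /\
    f (i, j) (i', j) = f (i, j') (i', j') /\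
    f (i, j) (i, j') = f (i', j) (i', j').

(* n has the property defining G(r): every r-edge-coloring of Gamma_{n,n}
   contains an alternating rectangle.  G(r) is the least such n. *)
Definition forces_alt_rect (r n : nat) : Prop :=
  forall f : coloring n r, sym_coloring f -> has_alt_rect f.

Definition log2 (x : R) : R := (ln x / ln 2)%R.

(* Main.v *)
(* A column of the grid is an edge coloring of the complete graph on the rows,
   and an alternating rectangle is avoided iff for any two columns the graph of
   the row pairs on which they agree is r-colorable.  Take a single coloring D of
   the pairs of rows such that few colors of D span a graph of small chromatic
   number, and obtain the columns by composing D with the words of a
   Reed-Solomon code, so that two columns agree on few colors of D only.

   For D, use Mubayi's coloring of pairs of words: record the first position
   where x and y differ, the letter of x there, and the set of all positions
   where they differ.  A set X of these colors spans a graph colorable with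
   2 ^ K * (1 + |X| ^ 2) ^ (|X| / K) colors: as long as some index lies in more
   than K difference sets of X, branch on the letter at that position; either it
   differs from all letters recorded in X, which kills the colors with that index,
   or it is known exactly, which kills more than K colors.  When no such index is
   left, K parity bits suffice.  Using k-tuples of words balances the number of
   rows against the number of columns; the optimum is k ~ sqrt (u / l) and
   K = k * l, where u ~ log r and l ~ log log r. *)
Require Import Defs.
From Stdlib Require Import Reals Lra.
From mathcomp Require Import all_boot all_algebra all_field.
From mathcomp Require Import zify.
Set Implicit Arguments.
Unset Strict Implicit.
Unset Printing Implicit Defensive.

(** * Proper colorings, products and greedy splitting *)

Definition colorable (T : Type) (e : T -> T -> Prop) (n : nat) : Prop :=
  exists c : T -> 'I_n, forall x y, e x y -> c x <> c y.

Lemma colorable_leq (T : Type) (e : T -> T -> Prop) (m n : nat) :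
  (m <= n)%N -> colorable e m -> colorable e n.
Proof.
move=> le_mn [c cP]; exists (fun x => widen_ord le_mn (c x)) => x y /cP neq eqc.
by apply: neq; apply: val_inj; apply: (congr1 val eqc).
Qed.

Lemma colorable_fin (T : Type) (e : T -> T -> Prop) (C : finType) (c : T -> C) :
  (forall x y, e x y -> c x <> c y) -> colorable e #|C|.
Proof.
move=> cP; exists (fun x => enum_rank (c x)) => x y /cP neq /enum_rank_inj.
exact: neq.
Qed.

Lemma colorable_prod (T : Type) (k : nat) (e : 'I_k -> T -> T -> Prop)
    (n : 'I_k -> nat) :
  (forall b, colorable (e b) (n b)) ->
  colorable (fun x y : 'I_k -> T => exists b, e b (x b) (y b))
    (\prod_(b < k) n b).
Proof.
move=> col.
have [c cP] : exists c : forall b, T -> 'I_(n b),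
    forall b x y, e b x y -> c b x <> c b y.
  exact: (fin_all_exists (P := fun b c => forall x y, e b x y -> c x <> c y)).
have -> : \prod_(b < k) n b = #|{dffun forall b : 'I_k, 'I_(n b)}|.
  rewrite card_dep_ffun foldrE big_map big_enum /=.
  by apply: eq_bigr => b _; rewrite card_ord.
apply: (@colorable_fin _ _ _ (fun x => [ffun b => c b (x b)] : {dffun _})).
move=> x y [b /cP neq] /ffunP /(_ b); rewrite !ffunE; exact: neq.
Qed.

(** Remove an element [a] of largest [h] and classify the rest first. By maximality [d a a'] forces
    equal [h], hence also [d a' a], so all conflicts of [a] are counted in its degree. That degree
    counts [a] itself, so one of the [K] classes stays free. *)
Lemma greedy_classes (T : finType) (d : rel T) (h : T -> nat) (K : nat)
    (X : {set T}) :
  (forall a a', d a a' -> h a <= h a')%N ->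
  (forall a a', h a = h a' -> d a a') ->
  {in X, forall a', #|[set a in X | d a a']| <= K}%N ->
  exists cl : T -> nat,
    {in X, forall a, cl a < K}%N /\
    {in X &, forall a a', d a a' -> a != a' -> cl a != cl a'}.
Proof.
move=> dh hd; have [n] := ubnP #|X|; elim: n => // n IHn in X * => ltXn degX.
have [-> | [a0 a0X]] := set_0Vmem X.
  by exists (fun=> 0); split=> [a | a a']; rewrite inE.
have [a aX amax] : exists2 a, a \in X & {in X, forall a', h a' <= h a}%N.
  by case: (arg_maxnP h a0X) => a aX amax; exists a.
have [||cl [clK clP]] := IHn (X :\ a).
- by rewrite (cardsD1 a) aX in ltXn.
- move=> a' /setD1P [_ /degX]; apply: leq_trans; apply: subset_leq_card.
  by apply/subsetP=> x; rewrite !inE => /andP [/andP [_ ->] ->].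
pose A := [set a' in X :\ a | d a' a].
have ltAK : (#|A| < K)%N.
  apply: leq_trans (degX a aX); rewrite [leqRHS](cardsD1 a) !inE aX hd //=.
  rewrite add1n ltnS; apply: subset_leq_card; apply/subsetP=> x.
  by rewrite !inE => /andP [/andP [-> ->] ->].
have [v vK vA] : exists2 v, (v < K)%N & v \notin [seq cl a' | a' in A].
  have [/allP sub | /allPn [v]] := boolP (all (mem [seq cl a' | a' in A]) (iota 0 K)).
    have := uniq_leq_size (iota_uniq 0 K) sub.
    by rewrite size_iota size_image leqNgt ltAK.
  by rewrite mem_iota => vK vA; exists v.
have fresh a' : a' \in X -> a' != a -> d a' a -> cl a' != v.
  move=> a'X neq da'; apply: contra vA => /eqP <-.
  by apply: image_f; rewrite !inE neq a'X.
exists (fun a' => if a' == a then v else cl a'); split=> [a' a'X | a1 a2 X1 X2 d12].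
  by case: eqVneq => // neq; apply: clK; rewrite !inE neq.
have [eq1 | neq1] := eqVneq a1 a; have [eq2 | neq2] := eqVneq a2 a => neq.
- by rewrite eq1 eq2 eqxx in neq.
- rewrite eq_sym; apply: fresh => //; apply: hd; apply/eqP.
  by rewrite eqn_leq amax //= -eq1 dh.
- by apply: fresh => //; rewrite -eq2.
- by apply: clP; rewrite ?inE ?neq1 ?neq2.
Qed.

(** * Chromatic number of a few classes of the difference coloring *)

Section DifferenceColoring.

Variables (t : nat) (A : finType).

Definition dcolor : finType := ('I_t * A * {set 'I_t})%type.

Implicit Types (x y : {ffun 'I_t -> A}) (al : dcolor) (X : {set dcolor}).

Definition diff x y : {set 'I_t} := [set j | x j != y j].

Lemma in_diff x y j : (j \in diff x y) = (x j != y j).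
Proof. by rewrite inE. Qed.

Definition dindex al : 'I_t := al.1.1.

(* Cutting the third component at the dindex makes every triple well formed. *)
Definition supp al : {set 'I_t} := dindex al |: [set j in al.2 | (dindex al < j)%N].

Definition has_dcolor al x y : Prop := x (dindex al) = al.1.2 /\ diff x y = supp al.

Lemma dindex_supp al : dindex al \in supp al.
Proof. exact: setU11. Qed.

Lemma dindex_min al j : j \in supp al -> (dindex al <= j)%N.
Proof. by rewrite !inE => /orP [/eqP -> // | /andP [_ /ltnW]]. Qed.

Lemma has_dcolor_neq al x y : has_dcolor al x y -> y (dindex al) != al.1.2.
Proof.
by case=> <- dxy; have := dindex_supp al; rewrite -dxy in_diff eq_sym.
Qed.

Lemma has_dcolor_eq al x y j : has_dcolor al x y -> j \notin supp al -> x j = y j.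
Proof. by case=> _ <-; rewrite in_diff negbK => /eqP. Qed.

Lemma has_dcolor_ex x y : x != y -> exists al, has_dcolor al x y.
Proof.
move=> neq; have [j jP] : exists j, j \in diff x y.
  apply/existsP; apply: contraR neq => /existsPn eqxy.
  by apply/eqP/ffunP=> j; apply/eqP; have := eqxy j; rewrite in_diff negbK.
have [i iP imin] : exists2 i, x i != y i & forall j', x j' != y j' -> (i <= j')%N.
  case: (arg_minnP (@nat_of_ord t) jP) => i iP imin; exists i.
    by rewrite -in_diff.
  by move=> j'; rewrite -in_diff; apply: imin.
exists (i, x i, diff x y); split=> //; apply/setP=> j'.
rewrite /supp /dindex !inE /=; have [-> | neqj] /= := eqVneq j' i.
  exact: iP.
have [dj' | //] := boolP (x j' != y j').
by rewrite ltn_neqAle imin // andbT eq_sym neqj.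
Qed.

Definition dgraph X x y : Prop := exists2 al, al \in X & has_dcolor al x y.

(* Splitting X into K classes such that the index of a member never lies in the
   support of another member of the class, an edge of the class flips exactly one of the
   bits [x (dindex al) == al.1.2], hence the parity of their number. *)
Lemma dgraph_sparse X (K : nat) :
  {in X, forall al', #|[set al in X | dindex al' \in supp al]| <= K}%N ->
  colorable (dgraph X) (2 ^ K).
Proof.
move=> degX.
pose d al al' := dindex al' \in supp al.
have dmin al al' : d al al' -> (dindex al <= dindex al')%N := @dindex_min al _.
have deq al al' : (dindex al : nat) = dindex al' -> d al al'.
  by move/val_inj=> eqi; rewrite /d -eqi dindex_supp.
have [cl [clK clP]] := greedy_classes dmin deq degX.
pose bit x al := x (dindex al) == al.1.2.
pose par x : {ffun 'I_K -> bool} :=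
  [ffun k : 'I_K => \big[addb/false]_(al in X | cl al == k) bit x al].
have -> : (2 ^ K)%N = #|{ffun 'I_K -> bool}| by rewrite card_ffun card_bool card_ord.
apply: (@colorable_fin _ _ _ par) => x y [al alX xy] /ffunP.
move=> /(_ (Ordinal (clK _ alX))); rewrite !ffunE /=.
rewrite (bigD1 al) ?alX //= [RHS](bigD1 al) ?alX //=.
have -> : bit x al by rewrite /bit xy.1.
rewrite [bit y al]negbTE ?(has_dcolor_neq xy) //.
set P := \big[_/_]_(_ | _) _; set Q := \big[_/_]_(_ | _) _.
suff -> : P = Q by case: Q.
apply: eq_bigr => a /andP [/andP [aX /eqP cla] neq].
rewrite /bit (has_dcolor_eq xy) //; apply/negP=> ia.
by have := clP _ _ alX aX ia; rewrite eq_sym neq cla eqxx => /(_ isT).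
Qed.

(** Each letter in [W] gets its own palette of [q] colors: an edge with [x j = y j] has [j] outside
    its support. Words whose letter at [j] is outside [W] start no edge of index [j] and share the
    [p] colors. *)
Lemma dgraph_branch X j (p q : nat) :
  colorable (dgraph [set al in X | dindex al != j]) p ->
  colorable (dgraph [set al in X | j \notin supp al]) q ->
  colorable (dgraph X) (p + #|X| * q).
Proof.
move=> [c0 c0P] [c1 c1P].
pose W := [set al.1.2 | al in X & dindex al == j].
have leW : (#|W| <= #|X|)%N.
  apply: leq_trans (leq_imset_card _ _) _.
  by apply: subset_leq_card; apply/subsetP=> al; rewrite inE => /andP [].
have inW al x y : al \in X -> has_dcolor al x y -> dindex al = j -> x j \in W.
  move=> alX [xal _] alj; rewrite -{1}alj xal.
  by apply: imset_f; rewrite inE alX alj eqxx.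
have [W0 | [w wW]] := set_0Vmem W.
  apply: (@colorable_leq _ _ p); first exact: leq_addr.
  exists c0 => x y [al alX xy]; apply: c0P; exists al => //; rewrite inE alX.
  by apply/eqP=> /(inW _ _ _ alX xy); rewrite W0 inE.
have -> : (p + #|X| * q)%N = #|{: 'I_p + 'I_#|X| * 'I_q}|.
  by rewrite card_sum card_prod !card_ord.
pose c x : 'I_p + 'I_#|X| * 'I_q :=
  if x j \in W then inr (widen_ord leW (enum_rank_in wW (x j)), c1 x)
  else inl (c0 x).
apply: (@colorable_fin _ _ _ c) => x y [al alX xy]; rewrite /c.
have [xW | xW] := boolP (x j \in W); have [yW | yW] := boolP (y j \in W) => //.
  case=> eqj; apply: c1P; exists al => //; rewrite inE alX.
  have {}eqj : x j = y j.
    by apply: (enum_rank_in_inj xW yW (Ax0 := wW) (Ay0 := wW)); apply: val_inj.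
  by rewrite -xy.2 in_diff eqj eqxx.
case; apply: c0P; exists al => //; rewrite inE alX.
by apply: contraNneq xW => /(inW _ _ _ alX xy).
Qed.

Lemma dgraph_colorable (N K s : nat) X : (0 < K)%N ->
  (#|X| <= N)%N -> (#|X| %/ K <= s)%N ->
  colorable (dgraph X) (2 ^ K * (1 + N ^ 2) ^ s).
Proof.
move=> K0 leN les.
have homo_exp e : {homo expn^~ e : m n / (m <= n)%N}.
  by move=> m n lemn; case: e => // e; rewrite leq_exp2r.
(* The base is made to depend on [#|X|]: losing a color lowers it by at least [N], which pays for
   the [#|X|] branches, while losing more than [K] colors lowers [s]. *)
apply: (@colorable_leq _ _ (2 ^ K * (1 + #|X| * N) ^ s)).
  by rewrite leq_mul2l homo_exp ?orbT // leq_add2l -mulnn leq_mul2r leN orbT.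
have [n] := ubnP #|X|; elim: n => // n IHn in X s leN les * => ltn.
have [/forall_inP sparse | /forall_inPn [a aX]] := boolP
    [forall a in X, #|[set al in X | dindex a \in supp al]| <= K]%N.
  apply: colorable_leq (dgraph_sparse sparse).
  by rewrite leq_pmulr ?expn_gt0.
rewrite -ltnNge; set j := dindex a => ltK.
pose X0 := [set al in X | dindex al != j].
pose X1 := [set al in X | j \notin supp al].
have lt0 : (#|X0| < #|X|)%N.
  apply: proper_card; apply/properP; split; last first.
    by exists a => //; rewrite inE eqxx andbF.
  by apply/subsetP=> al; rewrite inE => /andP [].
have eq1 : (#|X1| + #|[set al in X | j \in supp al]| = #|X|)%N.
  rewrite addnC -[RHS](cardsID [set al | j \in supp al]).
  by congr (_ + _)%N; apply: eq_card => al; rewrite !inE // andbC.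
(* [s = 0] would give [#|X| < K], but more than [K] supports contain [j]. *)
case: s => [|s] in les *; first by move: les; rewrite -ltnS ltn_divLR //; lia.
have les1 : (#|X1| %/ K <= s)%N.
  rewrite -ltnS; apply: leq_trans les.
  by rewrite leq_divRL // mulSn; have := leq_divM #|X1| K; lia.
have col0 : colorable (dgraph X0) (2 ^ K * (1 + #|X0| * N) ^ s.+1).
  apply: IHn; [lia | | lia].
  by apply: leq_trans les; apply: leq_div2r; lia.
have col1 : colorable (dgraph X1) (2 ^ K * (1 + #|X1| * N) ^ s).
  by apply: IHn => //; lia.
apply: colorable_leq (dgraph_branch col0 col1).
rewrite mulnCA -mulnDr leq_mul2l; apply/orP; right; rewrite expnS.
pose E := ((1 + #|X| * N) ^ s)%N.
have le0E : ((1 + #|X0| * N) ^ s <= E)%N.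
  by apply: homo_exp; rewrite leq_add2l leq_mul2r ltnW ?orbT.
have le1E : ((1 + #|X1| * N) ^ s <= E)%N.
  by apply: homo_exp; rewrite leq_add2l leq_mul2r -eq1 leq_addr orbT.
apply: (@leq_trans ((1 + #|X0| * N) * E + #|X| * E)).
  by rewrite leq_add // leq_mul2l ?le0E ?le1E orbT.
rewrite -mulnDl expnS -/E leq_mul2r; apply/orP; right; nia.
Qed.

End DifferenceColoring.

(** Blocks are colored independently and the bounds multiply. The quotients [#|X b| %/ K] sum to at
    most [s], so only [2 ^ K] is paid once per block. *)
Lemma blocks_colorable (k t s K : nat) (A : finType)
    (S : {set 'I_k * dcolor t A}) :
  (0 < K)%N -> (#|S| <= s * K)%N ->
  colorable (fun x y : {ffun 'I_k -> {ffun 'I_t -> A}} =>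
      exists2 bal, bal \in S & has_dcolor bal.2 (x bal.1) (y bal.1))
    (2 ^ (k * K) * (1 + (s * K) ^ 2) ^ s).
Proof.
move=> K0 leS; pose X (b : 'I_k) := [set al | (b, al) \in S].
have sumX : (\sum_(b < k) #|X b| = #|S|)%N.
  rewrite -sum1_card (eq_bigr (fun b => \sum_(al in X b) 1)%N) => [|b _]; last first.
    by rewrite sum1_card.
  rewrite pair_big_dep /=; apply: eq_bigl => -[b al] /=; by rewrite inE.
have sums : (\sum_(b < k) #|X b| %/ K <= s)%N.
  rewrite -(leq_pmul2r K0) big_distrl /=; apply: leq_trans leS.
  by rewrite -sumX; apply: leq_sum => b _; apply: leq_divM.
have colX b : colorable (dgraph (X b)) (2 ^ K * (1 + (s * K) ^ 2) ^ (#|X b| %/ K)).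
  apply: dgraph_colorable => //; apply: leq_trans leS.
  by rewrite -sumX (bigD1 b) //= leq_addr.
have [c cP] := colorable_prod colX.
apply: (@colorable_leq _ _ (\prod_(b < k) (2 ^ K * (1 + (s * K) ^ 2) ^ (#|X b| %/ K)))).
  rewrite big_split /= prod_nat_const card_ord -expnM mulnC [(K * k)%N]mulnC.
  by rewrite mulnC leq_mul2l -expn_sum leq_pexp2l ?orbT.
exists (fun x => c x) => x y [[b al] bS xy]; apply: cP; exists b; exists al => //.
by rewrite inE.
Qed.

Local Open Scope ring_scope.
Import GRing.Theory.

(* Reed-Solomon: distinct polynomials of size at most N agree at fewer than N points. *)
Lemma code_exists (F : finFieldType) (C : finType) (N : nat) :
  (#|C| <= #|F|)%N ->
  exists w : 'rV[F]_N -> C -> F, forall p q, p != q ->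
    (#|[set a | w p a == w q a]| <= N)%N.
Proof.
move=> leCF.
pose pt (a : C) : F := enum_val (widen_ord leCF (enum_rank a)).
have pt_inj : injective pt.
  move=> a b /enum_val_inj eqab; apply: enum_rank_inj; apply: val_inj.
  exact: (congr1 val eqab).
exists (fun p a => (rVpoly p).[pt a]) => p q neq.
have r0 : rVpoly p - rVpoly q != 0.
  by rewrite subr_eq0; apply: contra neq => /eqP /(can_inj rVpolyK) ->.
set B := [set _ | _].
have rB : all (root (rVpoly p - rVpoly q)) [seq pt a | a in B].
  apply/allP=> _ /imageP [a aB ->]; move: aB; rewrite inE => /eqP eqpq.
  by rewrite rootE hornerD hornerN eqpq subrr.
have uB : uniq [seq pt a | a in B] by rewrite map_inj_uniq ?enum_uniq.
have := max_poly_roots r0 rB uB; rewrite size_image => /ltnW leB.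
apply: leq_trans leB _; apply: leq_trans (size_polyD _ _) _.
by rewrite geq_max size_polyN !size_poly.
Qed.

Local Close Scope ring_scope.

(** * From codewords and a coloring of row pairs to a coloring of the grid *)

Section Grid.

Variables (n r N : nat) (C : finType) (D : 'I_n -> 'I_n -> C).
Variable w : 'I_n -> C -> 'I_r.

Hypothesis wP : forall j j' : 'I_n, j < j' ->
  #|[set a | w j a == w j' a]| <= N.
Hypothesis DP : forall S : {set C}, #|S| <= N ->
  colorable (fun i i' : 'I_n => i < i' /\ D i i' \in S) r.

(* Columns are colored by the codewords composed with D; the color of the pair
   {j, j'} in row i is a proper coloring of the graph on which the columns j and
   j' agree. *)
Lemma grid_coloring :
  exists f : coloring n r, sym_coloring f /\ ~ has_alt_rect f.
Proof.
have [h hP] : exists h : {set C} -> 'I_n -> 'I_r, forall S : {set C}, #|S| <= N ->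
    forall i i' : 'I_n, i < i' -> D i i' \in S -> h S i <> h S i'.
  apply: (fin_all_exists (P := fun (S : {set C}) c => #|S| <= N -> forall i i' : 'I_n,
    i < i' -> D i i' \in S -> c i <> c i')) => S.
  have [leS | gtS] := leqP #|S| N.
    have [c cP] := DP leS; exists c => _ i i' lti DS; exact: cP.
  (* A default for large sets, which never occur as agreement sets of distinct columns. *)
  by have [c _] := @DP set0 (leq_trans (eq_leq (cards0 _)) (leq0n _)); exists c.
(* [D] is controlled only for [i < i']; sorting makes the coloring symmetric. On an edge inside a
   row, [mn u.1 v.1] is that row. *)
pose mn (i i' : 'I_n) := if i <= i' then i else i'.
pose mx (i i' : 'I_n) := if i <= i' then i' else i.
have mnC i i' : mn i i' = mn i' i.
  by rewrite /mn; case: ltngtP => // /val_inj.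
have mxC i i' : mx i i' = mx i' i.
  by rewrite /mx; case: ltngtP => // /val_inj.
pose agree j j' := [set a | w j a == w j' a].
exists (fun u v => if u.2 == v.2 then w u.2 (D (mn u.1 v.1) (mx u.1 v.1))
  else h (agree (mn u.2 v.2) (mx u.2 v.2)) (mn u.1 v.1)); split.
  move=> u v; rewrite eq_sym mnC mxC [mn v.2 _]mnC [mx v.2 _]mxC.
  by case: eqP => // ->.
case=> i [i' [j [j' [lti [ltj [/=]]]]]].
rewrite !eqxx /mn /mx !leqnn !(ltnW lti) !(ltnW ltj).
case: eqP => [eqj | _]; first by rewrite eqj ltnn in ltj.
move=> eqw eqh; apply: hP eqh => //; first exact: wP.
by rewrite inE eqw.
Qed.

End Grid.

(** * Lower bounds with explicit parameters *)

Lemma forces_gt (n r m : nat) (f : coloring n r) :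
  sym_coloring f -> ~ has_alt_rect f -> forces_alt_rect r m -> n < m.
Proof.
move=> symf nf fm; rewrite ltnNge; apply/negP=> lemn; apply: nf.
pose e := widen_ord lemn.
have [|i [i' [j [j' [lti [ltj [eqv eqh]]]]]]] :=
    fm (fun u v => f (e u.1, e u.2) (e v.1, e v.2)).
  by move=> u v; apply: symf.
by exists (e i), (e i'), (e j), (e j').
Qed.

(* Rows are k-tuples of words of length t over 2 ^ t symbols; columns are
   codewords over the field with 2 ^ e elements. *)
Lemma forces_lower (e k t K s r n : nat) :
  0 < K -> 0 < e -> 0 < k -> 0 < t -> k * (t * 2 ^ t * 2 ^ t) <= 2 ^ e ->
  2 ^ e <= r -> 2 ^ (k * K) * (1 + (s * K) ^ 2) ^ s <= r ->
  k * (t * t) <= e * (s * K) ->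
  forces_alt_rect r n -> 2 ^ (k * (t * t)) < n.
Proof.
move=> K0 e0 k0 t0 lek ler lecol leN; set m := 2 ^ _.
have [F _ cardF] := PrimePowerField (isT : prime 2) e0.
pose A : finType := 'I_(2 ^ t).
pose C : finType := ('I_k * dcolor t A)%type.
have cardC : #|C| <= #|F|.
  rewrite cardF !card_prod !card_ord.
  by rewrite -[#|{set 'I_t}|]cardsT -powersetT card_powerset cardsT card_ord.
have [w wP] := code_exists (s * K) cardC.
pose V : finType := {ffun 'I_k -> {ffun 'I_t -> A}}.
have cardV : #|V| = m by rewrite !card_ffun !card_ord -!expnM /m [k * _]mulnC -mulnA.
pose v (i : 'I_m) : V := enum_val (cast_ord (esym cardV) i).
have vinj : injective v by move=> i i' /enum_val_inj /cast_ord_inj.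
(* There are [2 ^ (e * (s * K))] codewords, enough for [m] distinct columns. *)
have leW : m <= #|{: 'rV[F]_(s * K)}|.
  by rewrite card_mx cardF -expnM mul1n leq_pexp2l.
pose word (i : 'I_m) : 'rV[F]_(s * K) := enum_val (widen_ord leW i).
have word_inj : injective word.
  by move=> i i' /enum_val_inj eqi; apply: val_inj; apply: (congr1 val eqi).
have leFr : #|F| <= r by rewrite cardF.
have [a0 _] : exists a : C, true.
  by exists (Ordinal k0, (Ordinal t0, Ordinal (expn_gt0 2 t), set0)).
have [D0 DP] : exists D : 'I_m * 'I_m -> C, forall p : 'I_m * 'I_m,
    p.1 != p.2 -> has_dcolor (D p).2 (v p.1 (D p).1) (v p.2 (D p).1).
  apply: (fin_all_exists (P := fun p a => p.1 != p.2 ->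
       has_dcolor a.2 (v p.1 a.1) (v p.2 a.1))) => -[i i'] /=.
  have [_ | neq] := eqVneq i i'; first by exists a0.
  have [b neqb] : exists b, v i b != v i' b.
    apply/existsP; apply: contraR neq => /existsPn eqv.
    by apply/eqP/vinj/ffunP=> b; apply/eqP; have := eqv b; rewrite negbK.
  by have [al alP] := has_dcolor_ex neqb; exists (b, al).
have [f [symf nf]] : exists f : coloring m r, sym_coloring f /\ ~ has_alt_rect f.
  apply: (@grid_coloring _ _ (s * K) _ (fun i i' => D0 (i, i'))
    (fun j a => widen_ord leFr (enum_rank (w (word j) a)))) => [j j' ltj | S leS].
    apply: leq_trans (wP (word j) (word j') _).
      apply: subset_leq_card; apply/subsetP=> a; rewrite !inE => /eqP eqw.
      apply/eqP/enum_rank_inj/val_inj; exact: (congr1 val eqw).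
    by apply: contraTneq ltj => /word_inj ->; rewrite ltnn.
  have [c cP] := colorable_leq lecol (blocks_colorable K0 leS).
  exists (fun i => c (v i)) => i i' [lti DS]; apply: cP; exists (D0 (i, i')) => //.
  by apply: (DP (i, i')); apply: contraTneq lti => /= ->; rewrite ltnn.
exact: forces_gt symf nf.
Qed.

(** Take [t = u], [K = k * l], [s = k * k] with [k] maximal such that [k * k * l <= u]; the factor 4
    comes from [k.+1 <= 2 * k]. *)
Lemma forces_sqrt (u r n : nat) (l := (trunc_log 2 u).+1) :
  0 < u -> 2 ^ (10 * u) <= r -> forces_alt_rect r n ->
  exists k, u <= 4 * (k * k * l) /\ 2 ^ (k * (u * u)) < n.
Proof.
move=> u0 ler fn.
have ltul : u < 2 ^ l by apply: trunc_log_ltn.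
have lelu : l <= u.
  by apply: leq_trans (ltn_expl _ _) (trunc_logP _ u0).
pose P k := k * k * l <= u.
have P1 : exists k, P k by exists 1; rewrite /P !mul1n.
have Pu k : P k -> k <= u by rewrite /P /l; nia.
case: (ex_maxnP P1 Pu) => k; rewrite /P => lek kmax; exists k.
have k0 : 0 < k by apply: kmax; rewrite !mul1n.
have leu : u <= 4 * (k * k * l).
  have : ~~ (k.+1 * k.+1 * l <= u) by apply/negP=> /kmax; rewrite ltnn.
  by rewrite -ltnNge; nia.
have leku : k <= u by rewrite /l in lek *; nia.
split=> //.
have ltu : u < 2 ^ u by rewrite ltn_expl.
apply: (@forces_lower (10 * u) k u (k * l) (k * k) r) => //.
- by rewrite muln_gt0 k0.
- by rewrite muln_gt0.
- apply: (@leq_trans (2 ^ u * (2 ^ u * 2 ^ u * 2 ^ u))).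
    by rewrite !leq_mul // ltnW // (leq_ltn_trans leku).
  by rewrite -!expnD leq_pexp2l //; lia.
- apply: leq_trans ler.
  (* Hence [1 + (s * K) ^ 2 <= 2 ^ (4 * l)], and the number of colors is at most
     [2 ^ (u + 4 * (k * k * l))], so at most [2 ^ (5 * u)]. *)
  have lt2l : k * k * (k * l) < 2 ^ l * 2 ^ l.
    apply: (@leq_ltn_trans (u * u)); last by rewrite ltn_mul.
    by rewrite mulnCA mulnA -mulnA leq_mul // mulnA mulnC mulnA [l * _]mulnC mulnA.
  apply: (@leq_trans (2 ^ u * (2 ^ (4 * l)) ^ (k * k))).
    rewrite leq_mul // ?leq_pexp2l // ?mulnA //.
    rewrite leq_exp2r ?muln_gt0 ?k0 //.
    have -> : 4 * l = (l + l) + (l + l) by lia.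
    by rewrite !expnD -mulnn; nia.
  by rewrite -expnM -expnD leq_pexp2l //; nia.
- by nia.
Qed.

(** * Real logarithms and the final estimate *)

Lemma INR_expn (a : nat) : INR (2 ^ a) = Rpower 2 (INR a).
Proof.
rewrite Rpower_pow; last by lra.
by elim: a => // a IHa; rewrite expnS mult_INR IHa.
Qed.

Open Scope R_scope.

Lemma log2_ge (a : nat) (x : R) : INR (2 ^ a) <= x -> INR a <= log2 x.
Proof.
have ln2 : 0 < ln 2 by have := ln_lt_2; lra.
rewrite INR_expn => lex; rewrite /log2.
apply: (Rmult_le_reg_r (ln 2)) => //.
have -> : ln x / ln 2 * ln 2 = ln x by field; lra.
rewrite -(ln_exp (_ * _)); case: lex => [ltx | <-]; last exact: Rle_refl.
by apply/Rlt_le/ln_increasing => //; exact: exp_pos.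
Qed.

Lemma log2_lt (a : nat) (x : R) : 0 < x -> x < INR (2 ^ a) -> log2 x < INR a.
Proof.
have ln2 : 0 < ln 2 by have := ln_lt_2; lra.
rewrite INR_expn => x0 ltx; rewrite /log2.
apply: (Rmult_lt_reg_r (ln 2)) => //.
have -> : ln x / ln 2 * ln 2 = ln x by field; lra.
rewrite -(ln_exp (_ * _)); exact: ln_increasing.
Qed.

Lemma le_INR_leq (m n : nat) : (m <= n)%N -> INR m <= INR n.
Proof. by move/leP/le_INR. Qed.

(* "G(r) > B" is stated as: every n with the defining property of G(r)
   exceeds B (equivalently, the least such n exceeds B). *)
Theorem theorem1p2 :
  exists c : R, 0 < c /\
  exists r0 : nat, forall r : nat, (r0 <= r)%nat ->
    forall n : nat, forces_alt_rect r n ->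
      Rpower 2 (c * Rpower (log2 (INR r)) (5 / 2)
                  / sqrt (log2 (log2 (INR r)))) < INR n.
Proof.
(* 4000 is 400 from [L * L <= 400 * (U * U)] times 10 from [leq1]. *)
exists (/ 4000); split; first by lra.
(* This threshold ensures [u >= 1]. *)
exists (expn 2 10) => r ler n fn.
have r0 : (0 < r)%N by apply: leq_trans ler; rewrite expn_gt0.
pose T := trunc_log 2 r; pose u := (T %/ 10)%N; pose l := (trunc_log 2 u).+1.
have leT : (10 <= T)%N by apply: trunc_log_max.
have u0 : (0 < u)%N by rewrite divn_gt0.
have leu : (10 * u <= T)%N by rewrite mulnC leq_divM.
have leTr : (2 ^ T <= r)%N by apply: trunc_logP.
have [k [leuk ltn]] : exists k,
    (u <= 4 * (k * k * l))%N /\ (2 ^ (k * (u * u)) < n)%N.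
  by apply: forces_sqrt fn => //; apply: leq_trans leTr; rewrite leq_pexp2l.
set L := log2 (INR r).
have leL : INR (10 * u) <= L.
  by apply: log2_ge; apply: le_INR_leq; apply: leq_trans leTr; rewrite leq_pexp2l.
have ltL : L < INR (20 * u).
  apply: (@Rlt_le_trans _ (INR T.+1)).
    apply: log2_lt; first by apply: lt_0_INR; apply/ltP.
    by apply: lt_INR; apply/ltP; apply: trunc_log_ltn.
  by apply: le_INR_leq; have := divn_eq T 10; have := ltn_mod T 10; rewrite -/u; lia.
have lelL : INR l <= log2 L.
  apply: log2_ge; apply: Rle_trans leL; apply: le_INR_leq.
  by rewrite expnS leq_mul // trunc_logP.
have u1 : 1 <= INR u by apply: (le_INR_leq u0).
have l1 : 1 <= INR l by apply: (@le_INR_leq 1).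
move: leL ltL (le_INR_leq leuk); rewrite !mult_INR.
set U := INR u in u1 *; set k' := INR k; set l' := INR l in lelL l1 *.
have -> : INR 10 = 10 by simpl; lra.
have -> : INR 20 = 20 by simpl; lra.
have -> : INR 4 = 4 by simpl; lra.
move=> leL ltL leUk; have k'0 : 0 <= k' by exact: pos_INR.
apply: (@Rle_lt_trans _ (INR (2 ^ (k * (u * u))))); last by apply: lt_INR; apply/ltP.
rewrite INR_expn; apply: Rle_Rpower; first by lra.
rewrite !mult_INR -/k' -/U.
set S := sqrt (log2 L).
have S0 : 0 < S by apply: sqrt_lt_R0; lra.
have SS : S * S = log2 L by apply: sqrt_sqrt; lra.
have -> : 5 / 2 = 1 + 1 + / 2 by lra.
rewrite !Rpower_plus !Rpower_1; [|lra..].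
rewrite Rpower_sqrt; last by lra.
(* Here [L < 20 * U], [U <= 4 * (k' * k' * l')] and [l' <= S * S] give [L <= 80 * (k' * S) ^ 2]; 80
   is rounded up to 100. *)
have leq1 : sqrt L <= 10 * (k' * S).
  rewrite -(sqrt_square (10 * (k' * S))); last by nra.
  by apply: sqrt_le_1_alt; nra.
apply: (Rmult_le_reg_r S) => //.
have -> : / 4000 * (L * L * sqrt L) / S * S = / 4000 * (L * L * sqrt L) by field; lra.
have LL : L * L <= 400 * (U * U) by nra.
have := sqrt_pos L => sL.
have : L * L * sqrt L <= 400 * (U * U) * (10 * (k' * S)).
  by apply: Rmult_le_compat => //; nra.
by lra.
Qed.
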